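(* Let $A$ be the (block by point) incidence matrix of a quasi-symmetric $2$-$(37,9,8)$ design with intersection numbers $1$ and $3$. Let $C$ be a binary doubly even self-dual $[40,20]$ code containing the row span over $\mathbb{F}_2$ of the matrix $$\begin{bmatrix} & 1&1&1 \\ A& \vdots &\vdots &\vdots \\ & 1&1&1\end{bmatrix}$$ obtained from $A$ by appending three all-one columns (in coordinate positions $38,39,40$). Then $C$ has minimum weight $8$, and there is no codeword of $C$ of weight $8$ whose support contains the last three coordinates $\{38,39,40\}$.
   Context: A $t$-$(v,k,\lambda)$ design is a pair $(\mathcal{P},\mathcal{B})$ where $\mathcal{P}$ is a set of $v$ points and $\mathcal{B}$ is a collection of $k$-element subsets of $\mathcal{P}$ (called blocks; repeated blocks are in principle allowed) such that every $t$-element subset of $\mathcal{P}$ is contained in exactly $\lambda$ blocks. It is assumed that $t<k<v$. A $2$-design is called quasi-symmetric with intersection numbers $x$ and $y$ ($x<y$) if the number of points in the intersection of any two distinct blocks takes only the two values $x$ and $y$. The incidence matrix $A=(a_{ij})$ has $a_{ij}=1$ if the $j$th point is contained in the $i$th block, and $a_{ij}=0$ otherwise; its entries are regarded in $\mathbb{F}_2$. A binary $[n,k]$ code is a $k$-dimensional subspace of $\mathbb{F}_2^n$. The weight of a vector is its number of nonzero components, and its support is the set of positions of its nonzero components. The minimum weight of a code is the minimum weight of its nonzero codewords. A code is doubly even if all its codewords have weight divisible by $4$; it is self-dual if $C=C^\perp$, where $C^\perp=\{x\in\mathbb{F}_2^n \mid x\cdot y=0\text{ for all }y\in C\}$ for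 the standard inner product. *)

(* Defs.v *)
From mathcomp Require Import all_boot all_order all_algebra.

Set Implicit Arguments.
Unset Strict Implicit.
Unset Printing Implicit Defensive.

Import GRing.Theory.
Local Open Scope ring_scope.

(* The point set is 'I_v. The blocks form an indexed family, so that repeated
   blocks are allowed and the multiplicity of a block counts in lambda. *)
Definition is_design (t v k lambda b : nat) (B : 'I_b -> {set 'I_v}) : Prop :=
  [/\ (t < k < v)%N,
      forall i : 'I_b, #|B i| = k
    & forall T : {set 'I_v}, #|T| = t -> #|[set i : 'I_b | T \subset B i]| = lambda].

(* Distinct blocks are distinct members of the family: a block repeated as a
   set counts as two distinct blocks, which meet in k points. *)
Definition quasi_symmetric (v k lambda x y b : nat)
    (B : 'I_b -> {set 'I_v}) : Prop :=
  [/\ is_design 2 k lambda B,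
      (x < y)%N
    & forall i j : 'I_b, i != j -> #|B i :&: B j| = x \/ #|B i :&: B j| = y].

Definition incidence_mx (v b : nat) (B : 'I_b -> {set 'I_v}) : 'M['F_2]_(b, v) :=
  \matrix_(i < b, j < v) (j \in B i)%:R.

Definition row_span (m n : nat) (M : 'M['F_2]_(m, n)) : {vspace 'rV['F_2]_n} :=
  <<[seq row i M | i : 'I_m]>>%VS.

Definition supp (n : nat) (x : 'rV['F_2]_n) : {set 'I_n} :=
  [set j | x 0 j != 0].

Definition wt (n : nat) (x : 'rV['F_2]_n) : nat := #|supp x|.

Definition dotp (n : nat) (x y : 'rV['F_2]_n) : 'F_2 :=
  \sum_(j < n) x 0 j * y 0 j.

Definition dual_code (n : nat) (C : {vspace 'rV['F_2]_n}) : {set 'rV['F_2]_n} :=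
  [set x | [forall y in C, dotp x y == 0]].

Definition self_dual (n : nat) (C : {vspace 'rV['F_2]_n}) : Prop :=
  C =i dual_code C.

Definition doubly_even (n : nat) (C : {vspace 'rV['F_2]_n}) : Prop :=
  forall x : 'rV['F_2]_n, x \in C -> (4 %| wt x)%N.

Definition has_min_weight (n : nat) (C : {vspace 'rV['F_2]_n}) (d : nat) : Prop :=
  (exists x : 'rV['F_2]_n, [/\ x \in C, x != 0 & wt x = d]) /\
  (forall x : 'rV['F_2]_n, x \in C -> x != 0 -> (d <= wt x)%N).

(* Main.v *)
(* Let x be a codeword, S its support on the points, and s its weight on the
   last three coordinates. Self-duality makes every block meet S in m_i points
   with m_i = s (mod 2). Double counting gives sum m_i = 36 |S| and
   sum m_i^2 = |S| (36 + 8 (|S| - 1)) over the 148 blocks. If s is even, then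
   m_i (m_i - 2) >= 0 forces S to be empty or |S| >= 6; if s is odd, then
   m_i >= 1 forces |S| >= 5. Hence weight 4 is impossible. A weight 8 codeword
   with s = 3 has |S| = 5 and sum (m_i - 1) (m_i - 3) = 64, so 8 blocks contain
   S, while two blocks share at most 3 points.

   If all nonzero weights were at least 12, the vectors of weight 6 in a coset
   of C would have disjoint supports, so there would be at most 6 of them. But
   there are only 2^19 cosets of even weight, and 6 * 2^19 < 'C(40, 6). *)
Require Import Defs.
From mathcomp Require Import all_boot all_order all_algebra finfield.
From mathcomp Require Import zify.
Import GRing.Theory.

Set Implicit Arguments.
Unset Strict Implicit.
Unset Printing Implicit Defensive.

(** * Double counting in a design *)

(** Both sides count triples of a block and two of its points, one in [S] and one in [T]. Taking [T]
    to be all points gives the first moment of the intersection sizes, [T = S] the second. *)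
Lemma sum_card_setI_mul (v b : nat) (B : 'I_b -> {set 'I_v}) (S T : {set 'I_v}) :
  \sum_i #|S :&: B i| * #|T :&: B i| =
  \sum_(p in S) \sum_(q in T) #|[set i | [set p; q] \subset B i]|.
Proof.
have cardE (A D : {set 'I_v}) : #|A :&: D| = \sum_(p in A) (p \in D).
  rewrite -sum1_card big_mkcond [RHS]big_mkcond; apply: eq_bigr => p _.
  by rewrite inE; case: (p \in A); case: (p \in D).
under eq_bigr do rewrite !cardE big_distrlr.
rewrite exchange_big; apply: eq_bigr => p _.
rewrite exchange_big; apply: eq_bigr => q _.
rewrite -sum1_card [RHS]big_mkcond; apply: eq_bigr => i _.
by rewrite inE subUset !sub1set /=; case: (p \in B i); case: (q \in B i).
Qed.

Lemma sum_card_pair_blocks (v k lambda b : nat) (B : 'I_b -> {set 'I_v})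
    (p : 'I_v) (T : {set 'I_v}) :
  is_design 2 k lambda B -> p \in T ->
  \sum_(q in T) #|[set i | [set p; q] \subset B i]| =
  #|[set i | p \in B i]| + lambda * #|T|.-1.
Proof.
case=> _ _ Hl pT; rewrite (big_setD1 p) //=; congr (_ + _).
  by apply: eq_card => i; rewrite !inE setUid sub1set.
rewrite (cardsD1 p T) pT mulnC -sum_nat_const; apply: eq_bigr => q.
by rewrite !inE => /andP [qp _]; apply: Hl; rewrite cards2 eq_sym qp.
Qed.

(** The moment identity for [[set p]] and all points: each block through [p] contributes its [k]
    points, every other block contributes 0. *)
Lemma card_blocks_at (v k lambda b : nat) (B : 'I_b -> {set 'I_v}) (p : 'I_v) :
  is_design 2 k lambda B ->
  #|[set i | p \in B i]| * k = #|[set i | p \in B i]| + lambda * v.-1.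
Proof.
move=> HB; have [_ Hk _] := HB.
have := sum_card_setI_mul B [set p] setT.
rewrite big_set1 (sum_card_pair_blocks HB) ?inE // cardsT card_ord => <-.
rewrite -sum_nat_const big_mkcond; apply: eq_bigr => i _.
rewrite setTI Hk inE; case: ifPn => pB.
  by rewrite (setIidPl _) ?sub1set // cards1 mul1n.
rewrite (_ : _ :&: _ = set0) ?cards0 //; apply/setP => q; rewrite !inE.
by case: eqVneq => // ->; apply: negbTE.
Qed.

Lemma card_blocks_at37 (b : nat) (B : 'I_b -> {set 'I_37}) (p : 'I_37) :
  is_design 2 9 8 B -> #|[set i | p \in B i]| = 36.
Proof. by move/(card_blocks_at p); lia. Qed.

Lemma sum_card_setI37 (b : nat) (B : 'I_b -> {set 'I_37}) (S : {set 'I_37}) :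
  is_design 2 9 8 B -> \sum_i #|S :&: B i| = 36 * #|S|.
Proof.
move=> HB; have [_ Hk _] := HB.
have := sum_card_setI_mul B S setT.
under eq_bigr do rewrite setTI Hk.
under [RHS]eq_bigr => p _ do
  rewrite (sum_card_pair_blocks HB) ?inE // (card_blocks_at37 _ HB) cardsT card_ord.
by rewrite -big_distrl sum_nat_const /=; lia.
Qed.

Lemma card_blocks37 (b : nat) (B : 'I_b -> {set 'I_37}) :
  is_design 2 9 8 B -> b = 148.
Proof.
move=> HB; have [_ Hk _] := HB; have := sum_card_setI37 setT HB.
under eq_bigr do rewrite setTI Hk.
by rewrite sum_nat_const cardsT !card_ord; lia.
Qed.

Lemma sum_card_setI_sqr37 (b : nat) (B : 'I_b -> {set 'I_37}) (S : {set 'I_37}) :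
  is_design 2 9 8 B ->
  \sum_i #|S :&: B i| * #|S :&: B i| = #|S| * (36 + 8 * #|S|.-1).
Proof.
move=> HB; rewrite sum_card_setI_mul -sum_nat_const; apply: eq_bigr => p pS.
by rewrite (sum_card_pair_blocks HB) // (card_blocks_at37 _ HB).
Qed.

(** Even m satisfies 2m <= m^2; summing and cancelling |S| gives 72 <= 36 + 8 (|S| - 1). *)
Lemma card_even_set37 (b : nat) (B : 'I_b -> {set 'I_37}) (S : {set 'I_37}) :
  is_design 2 9 8 B ->
  (forall i, ~~ odd #|S :&: B i|) -> 0 < #|S| -> 6 <= #|S|.
Proof.
move=> HB evS S_gt0.
have: \sum_i 2 * #|S :&: B i| <= \sum_i #|S :&: B i| * #|S :&: B i|.
  by apply: leq_sum => i _; have := evS i; case: #|_| => [|[|n]] // _; lia.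
rewrite -big_distrr /= (sum_card_setI37 _ HB) (sum_card_setI_sqr37 _ HB).
by case: #|S| S_gt0 => [|n] // _; rewrite mulnA mulnC leq_pmul2l //; lia.
Qed.

(** Each of the 148 blocks meets [S], so 148 <= 36 |S|. *)
Lemma card_odd_set37 (b : nat) (B : 'I_b -> {set 'I_37}) (S : {set 'I_37}) :
  is_design 2 9 8 B ->
  (forall i, odd #|S :&: B i|) -> 5 <= #|S|.
Proof.
move=> HB odS.
have: \sum_(i < b) 1 <= \sum_i #|S :&: B i|.
  by apply: leq_sum => i _; apply: odd_gt0.
by rewrite sum1_card card_ord (sum_card_setI37 _ HB) (card_blocks37 HB); lia.
Qed.

Lemma no_odd_set5 (b : nat) (B : 'I_b -> {set 'I_37}) (S : {set 'I_37}) :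
  is_design 2 9 8 B ->
  (forall i j, i != j -> #|B i :&: B j| <= 3) ->
  (forall i, odd #|S :&: B i|) -> #|S| != 5.
Proof.
move=> HB HI odS; apply/eqP => S5.
(* At most one block contains [S]; [i0] is that block, or an arbitrary one if there is none. *)
have [i0 H0] : exists i0, forall i, i != i0 -> #|S :&: B i| <= 3.
  have b_gt0 : 0 < b by rewrite (card_blocks37 HB).
  case: (pickP (fun i => 3 < #|S :&: B i|)) => [i0 gt3|le3]; last first.
    by exists (Ordinal b_gt0) => i _; rewrite leqNgt le3.
  exists i0 => i ne; apply: leq_trans (HI i i0 ne).
  apply: subset_leq_card; apply/subsetP => p; rewrite !inE => /andP [pS ->] /=.
  (* An odd number above 3 and at most 5 is 5, so [B i0] contains [S]. *)
  have : S :&: B i0 == S.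
    rewrite eqEcard subsetIl S5.
    by have := odS i0; move: gt3; case: #|_| => [|[|[|[|[|n]]]]].
  by move=> /eqP /setIidPl /subsetP; apply.
have le5 i : #|S :&: B i| <= 5 by rewrite -[leqRHS]S5 subset_leq_card ?subsetIl.
(* An odd m <= 5 has (m - 1) (m - 3) = 0 except at m = 5, where it is 8. *)
have: \sum_i (#|S :&: B i| * #|S :&: B i| + 3) <=
      \sum_i (4 * #|S :&: B i| + 8 * (i == i0)).
  apply: leq_sum => i _; have := odS i; have := le5 i; have := H0 i.
  by case: eqP => _; case: #|_| => [|[|[|[|[|[|n]]]]]] //= /(_ isT); lia.
(* The sums are 5 * 68 + 3 * 148 = 784 on the left and 4 * 180 + 8 = 728 on the right. *)
rewrite big_split [leqRHS]big_split /= (sum_card_setI_sqr37 _ HB) sum_nat_const card_ord.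
rewrite -big_distrr (sum_card_setI37 _ HB) -big_distrr (bigD1 i0) //= eqxx.
by rewrite big1 => [|i /negbTE -> //]; rewrite S5 (card_blocks37 HB).
Qed.

(** After cancelling one factor [2 ^ 20], this is 41943040 < 46060560. The powers stay factored or
    abstract so that no large unary numeral is computed. *)
Lemma bin_40_6_gt : 40 * 2 ^ (20 + 20) < 2 * ('C(40, 6) * 6 * 2 ^ 20).
Proof.
have E : 'C(40, 6) * 6`! = 40 * (39 * (38 * (37 * (36 * 35)))).
  rewrite bin_ffact !ffactSS ffactn0 muln1; exact: erefl.
have: 40 * 2 ^ 20 < 2 * ('C(40, 6) * 6).
  rewrite (expnD 2 10 10 : 2 ^ 20 = _) -[2 ^ 10]/(1024).
  move: E; rewrite -[6`!]/720; generalize 'C(40, 6) => K; lia.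
have: 0 < 2 ^ 20 by rewrite expn_gt0.
rewrite expnD; generalize (2 ^ 20) 'C(40, 6) => M K M_gt0.
by move=> lt_KM; rewrite (mulnA 40) (mulnA 2) ltn_pmul2r.
Qed.

Local Open Scope ring_scope.

(** * Supports, weights and parity of binary vectors *)

Lemma F2_natE (a : 'F_2) : a = (a != 0)%:R.
Proof. by case: a => [[|[|n]] H] //; apply: val_inj. Qed.

Lemma natF2_eq0 (n : nat) : ((n%:R : 'F_2) == 0) = ~~ odd n.
Proof. by rewrite -(dvdn_pcharf (pchar_Fp (isT : prime 2))) dvdn2. Qed.

Lemma supp_inj (n : nat) : injective (@supp n).
Proof.
move=> x y /setP E; apply/rowP => j; have := E j; rewrite !inE => E'.
by rewrite [LHS]F2_natE [RHS]F2_natE E'.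
Qed.

Lemma wt_gt0 (n : nat) (x : 'rV['F_2]_n) : (0 < wt x)%N = (x != 0).
Proof.
rewrite lt0n cards_eq0; congr negb.
have <- : supp (0 : 'rV['F_2]_n) = set0.
  by apply/setP => j; rewrite !inE mxE eqxx.
exact: (inj_eq (@supp_inj n)).
Qed.

Lemma card_wt (n t : nat) : #|[set x : 'rV['F_2]_n | wt x == t]| = 'C(n, t).
Proof.
rewrite -[n in RHS]card_ord -card_draws -(card_imset _ (@supp_inj n)).
apply: eq_card => S; rewrite inE; apply/imsetP/idP => [[x] | S_t].
  by rewrite inE => /[swap] ->.
have SE : supp (\row_j (j \in S)%:R) = S.
  by apply/setP => j; rewrite inE mxE; case: (j \in S).
by exists (\row_j (j \in S)%:R); rewrite ?inE /wt SE.
Qed.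

Lemma sum_rowE (n : nat) (x : 'rV['F_2]_n) : \sum_j x 0 j = (wt x)%:R.
Proof.
rewrite /wt -sum1_card natr_sum [RHS]big_mkcond; apply: eq_bigr => j _.
by rewrite inE [LHS]F2_natE; case: (_ != 0).
Qed.

Lemma wtD_parity (n : nat) (x y : 'rV['F_2]_n) :
  odd (wt (x + y)) = odd (wt x) (+) odd (wt y).
Proof.
rewrite -oddD; apply: negb_inj; rewrite -!natF2_eq0 natrD -!sum_rowE.
by rewrite -big_split /=; congr (_ == 0); apply: eq_bigr => j _; rewrite mxE.
Qed.

(** The support of the difference lies in the union of the supports. Counting the overlap once is
    enough to push the weight strictly below the sum. *)
Lemma wtB (n : nat) (x y : 'rV['F_2]_n) :
  (wt (x - y) + #|supp x :&: supp y| <= wt x + wt y)%N.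
Proof.
rewrite /wt -(cardsUI (supp x)) leq_add2r subset_leq_card //; apply/subsetP => j.
rewrite !inE !mxE; case: (x 0 j =P 0) => [->|//]; case: (y 0 j =P 0) => [->|//].
by rewrite subrr eqxx.
Qed.

Lemma wt_delta (n : nat) (j : 'I_n) : wt (delta_mx 0 j) = 1%N.
Proof.
rewrite -[RHS](cards1 j); apply: eq_card => l; rewrite !inE mxE eqxx.
by case: (l == j).
Qed.

(** Adding a unit vector injects one parity class into its complement. *)
Lemma card_parity (n : nat) (a : bool) : (0 < n)%N ->
  (2 * #|[set x : 'rV['F_2]_n | odd (wt x) == a]| <= 2 ^ n)%N.
Proof.
case: n => // n _; set P := [set _ | _].
have -> : (2 ^ n.+1 = #|P| + #|~: P|)%N.
  by rewrite cardsC card_mx card_Fp // mul1n.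
rewrite mul2n -addnn leq_add2l.
have inj : injective (fun x : 'rV['F_2]_n.+1 => x + delta_mx 0 0) by apply: addIr.
rewrite -(card_imset _ inj) subset_leq_card //.
apply/subsetP => _ /imsetP [x Px ->]; move: Px.
by rewrite !inE wtD_parity wt_delta /= => /eqP ->; case: (a).
Qed.

(* A coset of C has pairwise disjoint vectors of weight t, because two of them
   differ by a codeword of weight at least 2t, and it lies in one parity class. *)
Lemma even_code_packing (n t : nat) (C : {vspace 'rV['F_2]_n}) : (0 < n)%N ->
  (forall x, x \in C -> ~~ odd (wt x)) ->
  (forall x, x \in C -> x != 0 -> (2 * t <= wt x)%N) ->
  (2 * ('C(n, t) * t * 2 ^ \dim C) <= n * 2 ^ n)%N.
Proof.
move=> n_gt0 Ceven Cmin.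
pose P := [set x : 'rV['F_2]_n | odd (wt x) == odd t].
pose W := [set x : 'rV['F_2]_n | wt x == t].
(* A triple (x, c, j) marks a position j in the support of x; sending it to (x + c, j) will be
   injective. *)
pose T := [set p : 'rV['F_2]_n * 'rV['F_2]_n * 'I_n |
  [&& p.1.1 \in W, p.1.2 \in C & p.2 \in supp p.1.1]].
pose f (p : 'rV['F_2]_n * 'rV['F_2]_n * 'I_n) := (p.1.1 + p.1.2, p.2).
have cardT : #|T| = ('C(n, t) * t * 2 ^ \dim C)%N.
  transitivity (\sum_(x in W) \sum_(c in C) #|supp x|)%N.
    rewrite pair_big /=; under [RHS]eq_bigr do rewrite -sum1_card.
    rewrite pair_big_dep /= -sum1_card; apply: eq_bigl => p.
    by rewrite !inE andbA.
  rewrite -card_wt -sum_nat_const big_distrl /=; apply: eq_bigr => x.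
  by rewrite inE sum_nat_const card_vspace card_Fp // mulnC => /eqP <-.
have f_inj : {in T &, injective f}.
  move=> [[x c] j] [[y d] l]; rewrite !inE /= => /and3P [/eqP xt cC jx].
  move=> /and3P [/eqP yt dC jy] [E jl]; subst l.
  (* Equal sums put x and y in the same coset, and the shared position j makes their distance less
     than 2t, hence 0. *)
  have xyE : x - y = d - c.
    by apply/eqP; rewrite subr_eq addrAC -subr_eq opprK E addrC.
  have xyC : x - y \in C by rewrite xyE rpredB.
  suff xy : x == y by rewrite (eqP xy) in E *; move/addrI: E => ->.
  rewrite -subr_eq0; apply: contraT => nz; have := Cmin _ xyC nz.
  have I_gt0 : (0 < #|supp x :&: supp y|)%N.
    by rewrite card_gt0; apply/set0Pn; exists j; rewrite !inE jx.
  move/leq_add => /(_ _ _ I_gt0) /leq_trans /(_ (wtB x y)).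
  by rewrite xt yt addn1 mul2n addnn ltnn.
have fT : f @: T \subset setX P setT.
  apply/subsetP => _ /imsetP [[[x c] j] + ->]; rewrite !inE /=.
  case/and3P => /eqP xt cC _.
  by rewrite wtD_parity (negbTE (Ceven c cC)) xt addbF eqxx.
have := subset_leq_card fT; rewrite (card_in_imset f_inj) cardT cardsX cardsT.
rewrite card_ord => le_T; apply: leq_trans (leq_mul (leqnn 2) le_T) _.
by rewrite mulnA mulnC leq_mul ?card_parity.
Qed.

(** * Splitting words into point coordinates and appended coordinates *)

Lemma wt_split (v w : nat) (x : 'rV['F_2]_(v + w)) :
  wt x = (wt (lsubmx x) + wt (rsubmx x))%N.
Proof.
have E m (y : 'rV['F_2]_m) : wt y = (\sum_j (y 0%R j != 0%R))%N.
  rewrite /wt -sum1_card [LHS]big_mkcond; apply: eq_bigr => j _.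
  by rewrite inE; case: (_ != 0).
rewrite !E big_split_ord /=.
by congr (_ + _)%N; apply: eq_bigr => j _; rewrite mxE.
Qed.

Lemma dotp_row_mx (v w : nat) (x : 'rV['F_2]_(v + w)) (a : 'rV_v) (c : 'rV_w) :
  dotp x (row_mx a c) = dotp (lsubmx x) a + dotp (rsubmx x) c.
Proof.
rewrite /dotp big_split_ord /=.
by congr (_ + _); apply: eq_bigr => j _; rewrite ?row_mxEl ?row_mxEr !mxE.
Qed.

Lemma dotp_incidence (v b : nat) (B : 'I_b -> {set 'I_v}) (x : 'rV['F_2]_v) i :
  dotp x (row i (incidence_mx B)) = #|supp x :&: B i|%:R.
Proof.
rewrite -sum1_card natr_sum [RHS]big_mkcond; apply: eq_bigr => j _.
by rewrite !inE !mxE [x 0 j in LHS]F2_natE -natrM mulnb; case: (_ && _).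
Qed.

Lemma dotp_const1 (w : nat) (x : 'rV['F_2]_w) : dotp x (const_mx 1) = (wt x)%:R.
Proof. by rewrite -sum_rowE; apply: eq_bigr => j _; rewrite mxE mulr1. Qed.

(** The extended row of block [i] lies in [C], hence is orthogonal to [x]; the inner product is the
    sum of the two counts modulo 2. *)
Lemma parity_blocks (v w b : nat) (B : 'I_b -> {set 'I_v})
    (C : {vspace 'rV['F_2]_(v + w)}) (x : 'rV['F_2]_(v + w)) i :
  self_dual C ->
  (row_span (row_mx (incidence_mx B) (const_mx 1 : 'M['F_2]_(b, w))) <= C)%VS ->
  x \in C -> odd #|supp (lsubmx x) :&: B i| = odd (wt (rsubmx x)).
Proof.
move=> Csd CA; rewrite Csd inE => /forall_inP xC.
have rC : row_mx (row i (incidence_mx B)) (const_mx 1) \in C.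
  suff <- : row i (row_mx (incidence_mx B) (const_mx 1 : 'M_(b, w))) =
            row_mx (row i (incidence_mx B)) (const_mx 1).
    by apply: (subvP CA); apply/memv_span/map_f; rewrite mem_enum.
  by rewrite row_row_mx row_const.
have := xC _ rC.
rewrite dotp_row_mx dotp_incidence dotp_const1 -natrD natF2_eq0 oddD.
by case: (odd _); case: (odd _).
Qed.

Theorem theorem7 (b : nat) (B : 'I_b -> {set 'I_37})
    (HB : quasi_symmetric 9 8 1 3 B)
    (C : {vspace 'rV['F_2]_40})
    (Cdim : \dim C = 20%N)
    (Cde : doubly_even C)
    (Csd : self_dual C)
    (CA : (row_span (row_mx (incidence_mx B) (const_mx 1 : 'M['F_2]_(b, 3)))
             <= C)%VS) :
  has_min_weight C 8 /\
  ~ (exists x : 'rV['F_2]_40,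
       [/\ x \in C, wt x = 8%N & [set j : 'I_40 | (37 <= j)%N] \subset supp x]).
Proof.
have [Hdes _ HI] := HB.
pose S (x : 'rV['F_2]_(37 + 3)) := supp (lsubmx x).
pose s (x : 'rV['F_2]_(37 + 3)) := wt (rsubmx x).
have par x i : x \in C -> odd #|S x :&: B i| = odd (s x).
  exact: (@parity_blocks 37 3 b B C x i Csd CA).
have wt_Ss x : wt x = (#|S x| + s x)%N by apply: (@wt_split 37 3).
have le_s3 x : (s x <= 3)%N by rewrite -[leqRHS]card_ord; apply: max_card.
have le3 i j : i != j -> (#|B i :&: B j| <= 3)%N by move=> /HI [|] ->.
have min8 x : x \in C -> x != 0 -> (8 <= wt x)%N.
  rewrite -wt_gt0 => xC x_gt0; have := Cde x xC.
  move: x_gt0; rewrite wt_Ss; have := le_s3 x; have := par x ^~ xC.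
  case: (boolP (odd (s x))) => s_par parS.
    by have := card_odd_set37 Hdes parS; lia.
  (* If [S x] is empty, the weight is [s x] <= 3, which is not a positive multiple of 4. *)
  have: (0 < #|S x|)%N -> (6 <= #|S x|)%N; last by lia.
  by apply: (card_even_set37 Hdes) => i; rewrite parS.
split; [split=> // | case=> x [xC x8 sub]].
  have [/exists_inP [x xC /eqP x8] | /exists_inPn no8] :=
    boolP [exists x in C, wt x == 8%N].
    by exists x; rewrite -wt_gt0 x8.
  (* Without weight 8, divisibility by 4 raises the minimum to 12 = 2 * 6, so the packing bound
     applies with t = 6. *)
  have : (2 * ('C(40, 6) * 6 * 2 ^ \dim C) <= 40 * 2 ^ (20 + 20))%N.
    apply: even_code_packing => // x xC; first by have := Cde x xC; lia.
    by move=> x0; have := min8 x xC x0; have := Cde x xC; have := no8 x xC; lia.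
  by rewrite Cdim => /(leq_trans bin_40_6_gt); rewrite ltnn.
have s3 : s x = 3%N.
  rewrite -[RHS](card_ord 3); apply: eq_card => j; rewrite !inE mxE.
  by have := subsetP sub (rshift 37 j); rewrite !inE leq_addr; apply.
have S5 : #|S x| = 5%N by apply: (@addIn 3); rewrite -[X in (_ + X)%N]s3 -wt_Ss x8.
have: #|S x| != 5%N by apply: (no_odd_set5 Hdes le3) => i; rewrite par ?s3.
by rewrite S5.
Qed.
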